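(* Let $\mathbf{C}$ be a purely rotating soliton with rotation matrix $\mathcal{A}$. Then its projection $\mathbf{Z}$ onto the null space $N(\mathcal{A})$ is contained in some line $\ell\subset N(\mathcal{A})$. The projection consists of either one point, a half line obtained by splitting $\ell$ at a point $P\in\ell$, or the line segment between two points $P,Q\in\ell$. If the projection is a half line or a line segment $m\subset\ell$, then the soliton is a graph over $m$ in $m\times R(\mathcal{A})$. The projected soliton approaches any endpoint of $m$ at an exponential rate, i.e. if $\lim_{s\to\pm\infty}\mathbf{Z}(s)=P$ then $\|\mathbf{Z}(s)-P\|\leq Ce^{-\delta|s|}$ for some $C,\delta>0$.
   Context: A purely rotating soliton with rotation matrix $\mathcal{A}$ (a real antisymmetric $n\times n$ matrix) is a curve $\mathbf{C}:\mathbb{R}\to\mathbb{R}^n$, parametrized by arc length $s$, which satisfies $\mathbf{C}_{ss}=\mathcal{A}\mathbf{C}+\lambda\mathbf{C}_s$, where $\lambda(s)=-\langle\mathcal{A}\mathbf{C},\mathbf{C}_s\rangle$ is determined by $\mathbf{C}_s\perp\mathbf{C}_{ss}$. $R(\mathcal{A})=N(\mathcal{A})^\perp$ is the range of $\mathcal{A}$, so $\mathbb{R}^n=N(\mathcal{A})\oplus R(\mathcal{A})$, and $\mathbf{Z}(s)$ is the orthogonal projection of $\mathbf{C}(s)$ onto $N(\mathcal{A})$. ''Graph over $m$ in $m\times R(\mathcal{A})$'' means that the $R(\mathcal{A})$-component of the points of the soliton is a function of their projection in $m$.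
   Formalization: The trichotomy is stated only for solitons not contained in N(A): straight lines in N(A) satisfy the equation and project onto a whole line. If N(A)={0}, which contains no line, ℓ is taken to be the point {0}. *)

(* Defs.v *)
From HB Require Import structures.
From mathcomp Require Import all_boot all_order all_algebra.
From mathcomp Require Import all_classical all_reals all_analysis.
Set Implicit Arguments.
Unset Strict Implicit.
Unset Printing Implicit Defensive.
Import Order.TTheory GRing.Theory Num.Theory.
Import numFieldNormedType.Exports.
Local Open Scope classical_set_scope.
Local Open Scope ring_scope.

(* Points of R^n are column vectors. The library norm on matrices is the sup
   norm, so the Euclidean inner product and norm are introduced here; the
   topology (limits, derivatives) is the same for both norms. *)
Definition dotp (R : realType) (n : nat) (u v : 'cV[R]_n) : R :=
  \sum_(i < n) u i 0 * v i 0.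

Definition enorm (R : realType) (n : nat) (u : 'cV[R]_n) : R :=
  Num.sqrt (dotp u u).

Definition null_space (R : realType) (n : nat) (A : 'M[R]_n) : set 'cV[R]_n :=
  [set x | A *m x = 0].

Definition range_space (R : realType) (n : nat) (A : 'M[R]_n) : set 'cV[R]_n :=
  range (fun x : 'cV[R]_n => A *m x).

Definition orth_proj (R : realType) (n : nat) (S : set 'cV[R]_n)
    (x z : 'cV[R]_n) : Prop :=
  S z /\ forall w, S w -> dotp (x - z) w = 0.

Definition lam (R : realType) (n : nat) (A : 'M[R]_n) (C : R -> 'cV[R]_n)
    (s : R) : R :=
  - dotp (A *m C s) (derive1 C s).

Definition rotating_soliton (R : realType) (n : nat) (A : 'M[R]_n)
    (C : R -> 'cV[R]_n) : Prop :=
  [/\ A^T = - A,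
      forall s, derivable C s 1,
      forall s, derivable (derive1 C) s 1,
      forall s, enorm (derive1 C s) = 1 &
      forall s, derive1n 2 C s = A *m C s + lam A C s *: derive1 C s].

Definition line (R : realType) (n : nat) (P v : 'cV[R]_n) : set 'cV[R]_n :=
  [set P + t *: v | t in [set: R]].

(* Half lines and segments do not contain their endpoints: the projection of a
   soliton only tends to them. *)
Definition ray (R : realType) (n : nat) (P v : 'cV[R]_n) : set 'cV[R]_n :=
  [set P + t *: v | t in [set t : R | 0 < t]].

Definition segment (R : realType) (n : nat) (P Q : 'cV[R]_n) : set 'cV[R]_n :=
  [set P + t *: (Q - P) | t in [set t : R | 0 < t < 1]].

(* If N(A) = 0 it contains no line; l is then the point N(A) itself. *)
Definition line_in_null_space (R : realType) (n : nat) (A : 'M[R]_n)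
    (l : set 'cV[R]_n) : Prop :=
  (exists P v, [/\ v != 0, l = line P v & l `<=` null_space A]) \/
  (null_space A = [set 0] /\ l = [set 0]).

Definition is_point (R : realType) (n : nat) (m : set 'cV[R]_n) : Prop :=
  exists P, m = [set P].

Definition half_line_of (R : realType) (n : nat) (l m : set 'cV[R]_n)
    (P : 'cV[R]_n) : Prop :=
  exists v, [/\ v != 0, l = line P v & m = ray P v].

Definition segment_of (R : realType) (n : nat) (l m : set 'cV[R]_n)
    (P Q : 'cV[R]_n) : Prop :=
  [/\ l P, l Q, P != Q & m = segment P Q].

(* segment P Q = segment Q P, so both ends of a segment are covered. *)
Definition endpoint (R : realType) (n : nat) (l m : set 'cV[R]_n)
    (P : 'cV[R]_n) : Prop :=
  half_line_of l m P \/ exists Q, segment_of l m P Q.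

(* The curve, as a set of points, is {z + f z | z in m} with z in N(A) and
   f z in R(A). *)
Definition graph_over (R : realType) (n : nat) (A : 'M[R]_n)
    (curve m : set 'cV[R]_n) : Prop :=
  exists f : 'cV[R]_n -> 'cV[R]_n,
    (forall z, m z -> range_space A (f z)) /\
    curve = [set z + f z | z in m].

(* The equation is also satisfied by straight lines lying in N(A), on which
   the rotation has no effect. *)
Definition stationary_line (R : realType) (n : nat) (A : 'M[R]_n)
    (C : R -> 'cV[R]_n) : Prop :=
  forall s, null_space A (C s).

(* Main.v *)
Require Import Defs.
From HB Require Import structures.
From mathcomp Require Import all_boot all_order all_algebra.
From mathcomp Require Import all_classical all_reals all_analysis.
From mathcomp Require Import ring lra.
Set Implicit Arguments.
Unset Strict Implicit.
Unset Printing Implicit Defensive.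
Import Order.TTheory GRing.Theory Num.Theory.
Import numFieldNormedType.Exports.
Local Open Scope classical_set_scope.
Local Open Scope ring_scope.

(** A component of the tangent along the null space of [A] obeys the linear
    equation [g' = lam g], because the rotational part [A *m C] of the
    acceleration is orthogonal to the null space. A solution of this equation
    that vanishes at one time is identically zero, so all the components of the
    tangent are proportional to a single one: the projection is constant, or
    runs along a line with a speed that never vanishes ([projection_profile]).

    Moreover the derivative [lam^2 - |A C|^2] of [lam] is minus the squared
    curvature, so [lam] is nonincreasing. It follows that the absolute value of
    [g s * exp (- lam s0 * (s - s0))] is greatest at [s = s0]
    ([linear_ode_bound]). This estimate gives the uniqueness used above and, at
    a time [s0] where [lam s0 < 0], the exponential decay of the speed, hence
    the exponential convergence of the projection as [s] tends to [+oo]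
    ([profile_tail]). If [lam] is nowhere negative, the speed is nondecreasing
    and the projection is unbounded on that side ([profile_unbounded]).
    Reversing time and the line turns [lam s] into [- lam (- s)]
    ([profile_reverse]) and settles the other side.

    If [lam] is identically zero, its derivative shows that [A *m C] is zero:
    the soliton is a stationary line. Otherwise [lam] takes a nonzero value, and
    a projection that is not constant is bounded on at least one side: it fills
    a half line or a segment ([range_projection]). Being injective, it makes the
    soliton a graph over its range ([graph_over_of_inj]). *)

(** * Scalar calculus *)

Lemma le_of_derive_ge0 (R : realType) (f df : R -> R) (a b : R) :
  (forall x, is_derive x (1 : R) f (df x)) -> a <= b ->
  (forall x, a <= x <= b -> 0 <= df x) -> f a <= f b.
Proof.
move=> fdf ab df0.
have [|c cab fab] := MVT_segment ab (fun x _ => fdf x).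
  by apply: derivable_within_continuous => x _; exact: ex_derive.
by rewrite -subr_ge0 fab mulr_ge0 ?subr_ge0// df0// -in_itv.
Qed.

Lemma lt_of_derive_gt0 (R : realType) (f df : R -> R) :
  (forall x, is_derive x (1 : R) f (df x)) -> (forall x, 0 < df x) ->
  {homo f : x y / x < y}.
Proof.
move=> fdf df0 a b ab.
have [|c cab fab] := MVT ab (fun x _ => fdf x).
  by apply: derivable_within_continuous => x _; exact: ex_derive.
by rewrite -subr_gt0 fab mulr_gt0 ?subr_gt0.
Qed.

Lemma IVT_derive (R : realType) (f df : R -> R) (a b v : R) :
  (forall x, is_derive x (1 : R) f (df x)) -> f a <= v <= f b ->
  exists c, f c = v.
Proof.
move=> fdf /andP[av vb].
have cf (i : interval R) : {within [set` i], continuous f}.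
  by apply: derivable_within_continuous => x _; exact: ex_derive.
case: (leP a b) => [ab|/ltW ba].
- have [|c _ fc] := IVT ab (cf _) (v := v); last by exists c.
  by rewrite ge_min av le_max vb orbT.
- have [|c _ fc] := IVT ba (cf _) (v := v); last by exists c.
  by rewrite ge_min av le_max vb !orbT.
Qed.

Lemma is_derive_comp_opp (R : realType) (f df : R -> R) (s : R) :
  (forall x, is_derive x (1 : R) f (df x)) ->
  is_derive s (1 : R) (fun x => f (- x)) (- df (- s)).
Proof.
move=> fdf; rewrite -mulrN1.
have dN : is_derive s (1 : R) (fun x : R => - x) (- 1) by apply: trigger_derive.
exact: (is_derive1_comp (f := f) (fdf (- s)) dN).
Qed.

Lemma is_derive_expR_lin (R : realType) (k a s : R) :
  is_derive s (1 : R) (fun x => expR (k * (x - a))) (k * expR (k * (s - a))).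
Proof.
have d1 : is_derive s (1 : R) (fun x => k * (x - a)) k.
  by apply: trigger_derive; rewrite /GRing.scale /=; ring.
rewrite mulrC.
have := @is_derive1_comp R expR (fun x => k * (x - a)) s _ _
  (is_derive_expR _) d1.
by [].
Qed.

Lemma cvg_pinfty_of_mono (R : realType) (u : R -> R) (L : R) :
  {homo u : x y / x <= y} -> (forall s, u s <= L) ->
  (forall y, y < L -> exists s, y < u s) -> u s @[s --> +oo] --> L.
Proof.
move=> um uL Lu; apply/cvgrPdist_le => e e0.
have [|s Ls] := Lu (L - e); first by rewrite ltrBlDr ltrDl.
near=> x.
rewrite ger0_norm ?subr_ge0// lerBlDl -lerBlDr; apply: le_trans (ltW Ls) _.
by apply: um; near: x; apply: nbhs_pinfty_ge; exact: num_real.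
Unshelve. all: by end_near. Qed.

(** A nondecreasing function with values on the ray [e + t * k], [t > 0], that takes
    all the values with [t < 1], tends to the origin [e] of the ray at one end. *)
Lemma mono_cvg_end (R : realType) (u : R -> R) (e k : R) :
  {homo u : x y / x <= y} -> k != 0 ->
  (forall s, exists2 t, 0 < t & u s = e + t * k) ->
  (forall t, 0 < t < 1 -> exists s, u s = e + t * k) ->
  (u s @[s --> +oo] --> e) \/ (u s @[s --> -oo] --> e).
Proof.
have key (w : R -> R) (e' k' : R) : {homo w : x y / x <= y} -> k' < 0 ->
    (forall s, exists2 t, 0 < t & w s = e' + t * k') ->
    (forall t, 0 < t < 1 -> exists s, w s = e' + t * k') ->
    w s @[s --> +oo] --> e'.
  move=> wm k0 we ew; apply: cvg_pinfty_of_mono => // [s|y ye].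
    by have [t t0 ->] := we s; rewrite gerDl pmulr_rle0// ltW.
  (* A parameter t < 1 small enough that e' + t * k' lies above y. *)
  have : 0 < (e' - y) / - k' by rewrite divr_gt0 ?subr_gt0// oppr_gt0.
  move Eq : ((e' - y) / - k') => q q0.
  pose t := Num.min (1 / 2) (q / 2).
  have t0 : 0 < t by rewrite lt_min; apply/andP; split; lra.
  have tq : t < q by apply: (@le_lt_trans _ _ (q / 2));
    [rewrite ge_min lexx orbT|lra].
  have t1 : t < 1.
    by apply: (@le_lt_trans _ _ (1 / 2)); [rewrite ge_min lexx|lra].
  have [|s ws] := ew t; first by rewrite t0 t1.
  by exists s; rewrite ws; move: tq; rewrite -Eq ltr_pdivlMr ?oppr_gt0//; lra.
move=> um; rewrite neq_lt => /orP[k0|k0] ue eu; first by left; exact: key ue eu.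
right; apply/cvgNy_compNP.
have : (- u (- s)) @[s --> +oo] --> - e.
  apply: (key _ _ (- k)) => [x y xy||s|t t01].
  - by rewrite lerN2 um// lerN2.
  - by rewrite oppr_lt0.
  - by have [t t0 ->] := ue (- s); exists t => //; rewrite opprD mulrN.
  - by have [s us] := eu t t01; exists (- s); rewrite opprK us opprD mulrN.
have <- : - (fun s => - u (- s)) = u \o -%R.
  by apply/funext => s; exact: opprK.
by move=> /cvgN uN; rewrite -[e]opprK; exact: uN.
Qed.

(** * The linear equation g' = lam g with nonincreasing lam *)

(** In absolute value, the solution lies below the exponential with the same value
    and the same logarithmic derivative at [s0], both forward and backward in
    time. *)
Lemma linear_ode_bound (R : realType) (lam g : R -> R) :
  {homo lam : x y / x <= y >-> y <= x} ->
  (forall s, is_derive s (1 : R) g (lam s * g s)) ->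
  forall s0 s, `|g s| <= `|g s0| * expR (lam s0 * (s - s0)).
Proof.
move=> lamN dg s0 s.
(* The square of k increases up to s0 and decreases afterwards, since its
   derivative has the sign of lam x - lam s0. *)
pose k x := g x * expR (- lam s0 * (x - s0)).
have dk x : is_derive x (1 : R) k ((lam x - lam s0) * k x).
  have ? := dg x; have ? := is_derive_expR_lin (- lam s0) s0 x.
  apply: (@trigger_derive _ _ _ _ _
    (is_deriveM (f := g) (g := fun x => expR (- lam s0 * (x - s0))) _ _)).
  by rewrite /GRing.scale /= /k; ring.
have dk2 x : is_derive x (1 : R) (k ^+ 2) (2 * (lam x - lam s0) * k x ^+ 2).
  have ? := dk x; apply: trigger_derive.
  by rewrite /GRing.scale /=; ring.
have dkN2 x : is_derive x (1 : R) (- k ^+ 2)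
    (- (2 * (lam x - lam s0) * k x ^+ 2)).
  by have ? := dk2 x; apply: trigger_derive.
have ks0 : k s0 = g s0 by rewrite /k subrr mulr0 expR0 mulr1.
have kmax : k s ^+ 2 <= k s0 ^+ 2.
  case: (leP s s0) => [ss0|/ltW s0s].
  - apply: (le_of_derive_ge0 dk2 ss0) => x /andP[_ xs0].
    by rewrite mulr_ge0 ?sqr_ge0// mulr_ge0// subr_ge0 lamN.
  - rewrite -lerN2; apply: (le_of_derive_ge0 dkN2 s0s) => x /andP[s0x _].
    by rewrite oppr_ge0 mulr_le0_ge0 ?sqr_ge0// mulr_ge0_le0// subr_le0 lamN.
have {kmax} : `|k s| <= `|g s0|.
  by rewrite -ks0 -ler_sqr ?nnegrE// !real_normK ?num_real.
rewrite /k normrM (ger0_norm (expR_ge0 _)) mulNr expRN ler_pdivrMr//.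
exact: expR_gt0.
Qed.

Lemma linear_ode_zero (R : realType) (lam g : R -> R) (s0 : R) :
  {homo lam : x y / x <= y >-> y <= x} ->
  (forall s, is_derive s (1 : R) g (lam s * g s)) ->
  g s0 = 0 -> forall s, g s = 0.
Proof.
move=> lamN dg g0 s; apply/eqP; rewrite -normr_le0.
by have := linear_ode_bound lamN dg s0 s; rewrite g0 normr0 mul0r.
Qed.

(** The position [u] of the projected soliton along its line, with its speed
    [g > 0], where the logarithmic derivative [lam] of the speed is
    nonincreasing. *)
Definition profile (R : realType) (lam g u : R -> R) : Prop :=
  [/\ {homo lam : x y / x <= y >-> y <= x}, forall s, 0 < g s,
      forall s, is_derive s (1 : R) u (g s) &
      forall s, is_derive s (1 : R) g (lam s * g s)].

Lemma profile_mono (R : realType) (lam g u : R -> R) :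
  profile lam g u -> {mono u : x y / x <= y}.
Proof.
by case=> _ g0 du _; apply/le_mono/(lt_of_derive_gt0 du).
Qed.

(** The equation is invariant under reversing both time and the line. *)
Lemma profile_reverse (R : realType) (lam g u : R -> R) :
  profile lam g u ->
  profile (fun s => - lam (- s)) (fun s => g (- s)) (fun s => - u (- s)).
Proof.
case=> lamN g0 du dg; split=> [x y xy|//|s|s].
- by rewrite lerN2 lamN// lerN2.
- have ? := is_derive_comp_opp s du; apply: trigger_derive; exact: opprK.
- by have := is_derive_comp_opp s dg; rewrite mulNr.
Qed.

(** After time [s] only an exponentially small distance remains to be covered. *)
Lemma profile_tail (R : realType) (lam g u : R -> R) (s0 : R) :
  profile lam g u -> lam s0 < 0 ->
  exists K d, [/\ 0 < K, 0 < d &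
    forall s t, u t - u s <= K * expR (- d * s)].
Proof.
move=> pu lam0; have [lamN g0 du dg] := pu.
pose d := - lam s0; have d0 : 0 < d by rewrite oppr_gt0.
pose K := g s0 * expR (d * s0) / d.
have K0 : 0 < K by rewrite divr_gt0// mulr_gt0// expR_gt0.
(* [U >= u] has derivative g minus the exponential majorant of g, so it is
   nonincreasing while u is increasing: every value of u is below all of U. *)
pose U s := u s + K * expR (- d * (s - 0)).
have dU s : is_derive s (1 : R) (- U) (g s0 * expR (- d * (s - s0)) - g s).
  have ds := du s; have de := is_derive_expR_lin (- d) 0 s.
  have -> : - U = - (u + K *: (fun s => expR (- d * (s - 0)))) by [].
  apply: (trigger_derive (is_deriveN (is_deriveD ds (is_deriveZ K de)))).
  rewrite /GRing.scale /= /K.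
  have -> : - d * (s - s0) = d * s0 + - d * (s - 0) by ring.
  rewrite expRD; field; exact: lt0r_neq0.
have uU0 r : u r <= U r by rewrite lerDl mulr_ge0// ?expR_ge0// ltW.
exists K, d; split=> // s t; rewrite lerBlDl -[X in expR (_ * X)]subr0.
case: (leP t s) => [ts|/ltW st].
  by apply: le_trans (uU0 s); rewrite (profile_mono pu).
apply: le_trans (uU0 t) _; rewrite -lerN2.
apply: (le_of_derive_ge0 dU st) => x _; rewrite subr_ge0.
by have := linear_ode_bound lamN dg s0 x; rewrite !gtr0_norm// opprK.
Qed.

Lemma profile_sup (R : realType) (lam g u : R -> R) (s0 : R) :
  profile lam g u -> lam s0 < 0 ->
  exists L, (forall s, u s < L) /\ (forall y, y < L -> exists s, y < u s).
Proof.
move=> pu /(profile_tail pu)[K [d [_ _ Kd]]].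
have supu : has_sup (range u).
  split; [by exists (u 0), 0|exists (u 0 + K * expR (- d * 0)) => _ [s _ <-]].
  by rewrite -lerBlDl.
exists (sup (range u)); split=> [s|y yL].
  apply: (@lt_le_trans _ _ (u (s + 1))).
    by rewrite (leW_mono (profile_mono pu)) ltrDl.
  by apply: ub_le_sup; [case: supu|exists (s + 1)].
have e0 : 0 < sup (range u) - y by rewrite subr_gt0.
have [_ [s _ <-]] := sup_adherent e0 supu.
by rewrite subKr; exists s.
Qed.

Lemma profile_inf (R : realType) (lam g u : R -> R) (s0 : R) :
  profile lam g u -> 0 < lam s0 ->
  exists L, (forall s, L < u s) /\ (forall y, L < y -> exists s, u s < y).
Proof.
move=> /profile_reverse pu lam0.
have [|L [uL Lu]] := profile_sup (s0 := - s0) pu.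
  by rewrite opprK oppr_lt0.
exists (- L); split=> [s|y Ly].
- by have := uL (- s); rewrite opprK ltrNl.
- have [|s ys] := Lu (- y); first by rewrite ltrNl.
  by exists (- s); rewrite -ltrN2.
Qed.

Lemma profile_unbounded (R : realType) (lam g u : R -> R) :
  profile lam g u -> (forall s, 0 <= lam s) ->
  forall M, exists s, M <= u s.
Proof.
move=> pu lam0 M; have [lamN g0 du dg] := pu.
pose s := Num.max 0 ((M - u 0) / g 0).
have s0 : 0 <= s by rewrite le_max lexx.
exists s.
have gm x : 0 <= x -> g 0 <= g x.
  by move=> x0; apply: (le_of_derive_ge0 dg x0) => y _; rewrite mulr_ge0// ltW.
have dh x : is_derive x (1 : R) (u - cst (g 0) * id) (g x - g 0).
  by have ? := du x; apply: trigger_derive; rewrite /GRing.scale /= /cst; ring.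
have := le_of_derive_ge0 dh s0 _.
have -> : (u - cst (g 0) * id) 0 = u 0 - g 0 * 0 by [].
have -> : (u - cst (g 0) * id) s = u s - g 0 * s by [].
rewrite mulr0 subr0 => H.
have {}H : u 0 <= u s - g 0 * s.
  by apply: H => x /andP[x0 _]; rewrite subr_ge0 gm.
have : M - u 0 <= g 0 * s by rewrite mulrC -ler_pdivrMr// le_max lexx orbT.
lra.
Qed.

Lemma profile_unbounded_below (R : realType) (lam g u : R -> R) :
  profile lam g u -> (forall s, lam s <= 0) ->
  forall M, exists s, u s <= M.
Proof.
move=> /profile_reverse pu lam0 M.
have [|s Ms] := profile_unbounded pu _ (- M).
  by move=> s; rewrite oppr_ge0.
by exists (- s); rewrite -lerN2.
Qed.

Lemma profile_bounded_lam (R : realType) (lam g u : R -> R) (M : R) :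
  profile lam g u -> (forall s, u s <= M) -> exists s, lam s < 0.
Proof.
move=> pu uM; apply: contrapT => lam0.
have [|s Ms] := profile_unbounded pu _ (M + 1).
  by move=> s; rewrite leNgt; apply/negP => ls; apply: lam0; exists s.
by have := uM s; lra.
Qed.

Lemma profile_surj (R : realType) (lam g u : R -> R) (a b y : R) :
  profile lam g u -> u a <= y -> y <= u b -> exists s, u s = y.
Proof.
case=> _ _ du _ ay yb; apply: (IVT_derive (a := a) (b := b) du).
by rewrite ay yb.
Qed.

(** * Euclidean geometry of R^n *)

Lemma dotpE (R : realType) (n : nat) (u v : 'cV[R]_n) :
  dotp u v = (u^T *m v) 0 0.
Proof. by rewrite /dotp !mxE; apply: eq_bigr => i _; rewrite mxE. Qed.

Lemma dotpC (R : realType) (n : nat) (u v : 'cV[R]_n) : dotp u v = dotp v u.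
Proof. by apply: eq_bigr => i _; rewrite mulrC. Qed.

Lemma dotpDl (R : realType) (n : nat) (u v w : 'cV[R]_n) :
  dotp (u + v) w = dotp u w + dotp v w.
Proof. by rewrite !dotpE linearD mulmxDl mxE. Qed.

Lemma dotpZl (R : realType) (n : nat) (a : R) (u v : 'cV[R]_n) :
  dotp (a *: u) v = a * dotp u v.
Proof. by rewrite !dotpE linearZ -scalemxAl mxE. Qed.

Lemma dotpBl (R : realType) (n : nat) (u v w : 'cV[R]_n) :
  dotp (u - v) w = dotp u w - dotp v w.
Proof. by rewrite -scaleN1r dotpDl dotpZl mulN1r. Qed.

Lemma dotpDr (R : realType) (n : nat) (u v w : 'cV[R]_n) :
  dotp w (u + v) = dotp w u + dotp w v.
Proof. by rewrite !(dotpC w) dotpDl. Qed.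

Lemma dotpZr (R : realType) (n : nat) (a : R) (u v : 'cV[R]_n) :
  dotp v (a *: u) = a * dotp v u.
Proof. by rewrite !(dotpC v) dotpZl. Qed.

Lemma dotpBr (R : realType) (n : nat) (u v w : 'cV[R]_n) :
  dotp w (u - v) = dotp w u - dotp w v.
Proof. by rewrite !(dotpC w) dotpBl. Qed.

Lemma dotp0r (R : realType) (n : nat) (u : 'cV[R]_n) : dotp u 0 = 0.
Proof. by rewrite -(scale0r 0) dotpZr mul0r. Qed.

Lemma dotp_ge0 (R : realType) (n : nat) (u : 'cV[R]_n) : 0 <= dotp u u.
Proof. by apply: sumr_ge0 => i _; rewrite -expr2 sqr_ge0. Qed.

Lemma dotp_eq0 (R : realType) (n : nat) (u : 'cV[R]_n) :
  dotp u u = 0 -> u = 0.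
Proof.
move=> /psumr_eq0P H; apply/matrixP => i j; rewrite ord1 mxE.
by apply/eqP; rewrite -sqrf_eq0 expr2 H// => k _; rewrite -expr2 sqr_ge0.
Qed.

Lemma dotp_mulmx_anti (R : realType) (n : nat) (A : 'M[R]_n) (u v : 'cV[R]_n) :
  A^T = - A -> dotp (A *m u) v = - dotp u (A *m v).
Proof. by move=> AT; rewrite !dotpE trmx_mul AT mulmxN mulNmx mulmxA mxE. Qed.

Lemma enormZ (R : realType) (n : nat) (a : R) (u : 'cV[R]_n) :
  enorm (a *: u) = `|a| * enorm u.
Proof.
by rewrite /enorm dotpZl dotpZr mulrA -expr2 sqrtrM ?sqr_ge0// sqrtr_sqr.
Qed.

Lemma enorm_gt0 (R : realType) (n : nat) (u : 'cV[R]_n) :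
  u != 0 -> 0 < enorm u.
Proof.
move=> u0; rewrite sqrtr_gt0 lt_neqAle dotp_ge0 andbT eq_sym.
by apply: contra_neq u0; exact: dotp_eq0.
Qed.

Lemma scale_vector_inj (R : realType) (n : nat) (a b : R) (v : 'cV[R]_n) :
  v != 0 -> a *: v = b *: v -> a = b.
Proof.
move=> v0 /eqP; rewrite -subr_eq0 -scalerBl scaler_eq0 (negbTE v0) orbF.
by rewrite subr_eq0 => /eqP.
Qed.

Lemma range_space_orth (R : realType) (n : nat) (A : 'M[R]_n) (x : 'cV[R]_n) :
  A^T = - A -> (forall w, null_space A w -> dotp x w = 0) -> range_space A x.
Proof.
move=> AT xN.
(* The columns of a cokernel of A lie in its null space. *)
have /submxP[D xD] : (x^T <= A)%MS.
  rewrite submxE; apply/eqP; move: (cokermx A) (mulmx_coker A) => B AB.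
  apply/matrixP => i j; rewrite (ord1 i) [RHS]mxE.
  have <- : dotp x (col j B) = 0.
    by apply: xN; rewrite /null_space /= colE mulmxA AB mul0mx.
  by rewrite dotpE colE mulmxA -colE [RHS]mxE.
exists (- D^T) => //; apply: trmx_inj.
by rewrite trmx_mul AT [(- D^T)^T]linearN /= trmxK mulmxN mulNmx opprK xD.
Qed.

(** * Derivatives of matrix-valued curves *)

Lemma is_derive_mxP (R : realType) (m n : nat) (M : R -> 'M[R]_(m, n))
    (D : 'M[R]_(m, n)) (t : R) :
  is_derive t (1 : R) M D <->
  forall i j, is_derive t (1 : R) (fun s => M s i j) (D i j).
Proof.
split=> [[dM <-] i j|MD].
  by apply: DeriveDef; [exact: (derivable_mxP _ _ _).1|rewrite derive_mx// mxE].
have dM : derivable M t 1 by apply/derivable_mxP => i j; case: (MD i j).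
apply: DeriveDef => //; rewrite derive_mx//; apply/matrixP => i j.
by rewrite mxE; case: (MD i j).
Qed.

Lemma is_derive_dotp (R : realType) (n : nat) (u v : R -> 'cV[R]_n)
    (du dv : 'cV[R]_n) (t : R) :
  is_derive t (1 : R) u du -> is_derive t (1 : R) v dv ->
  is_derive t (1 : R) (fun s => dotp (u s) (v s))
    (dotp du (v t) + dotp (u t) dv).
Proof.
move=> /is_derive_mxP udu /is_derive_mxP vdv.
have := is_derive_sum (fun i => is_deriveM (udu i 0) (vdv i 0)).
rewrite fct_sumE => H; apply: (trigger_derive H).
rewrite big_split addrC /= /dotp; congr (_ + _).
by apply: eq_bigr => i _; rewrite /GRing.scale /= mulrC.
Qed.

Lemma is_derive_mulmx (R : realType) (m n : nat) (A : 'M[R]_(m, n))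
    (u : R -> 'cV[R]_n) (du : 'cV[R]_n) (t : R) :
  is_derive t (1 : R) u du -> is_derive t (1 : R) (fun s => A *m u s) (A *m du).
Proof.
move=> /is_derive_mxP udu; apply/is_derive_mxP => i j.
have := is_derive_sum (fun k => is_deriveZ (A i k) (udu k j)).
rewrite fct_sumE => H; rewrite mxE.
have -> : (fun s => (A *m u s) i j) = (fun s => \sum_k A i k * u s k j).
  by apply/funext => s; rewrite mxE.
exact: H.
Qed.

(** * The soliton equation *)

Lemma is_derive_soliton (R : realType) (n : nat) (A : 'M[R]_n)
    (C : R -> 'cV[R]_n) (s : R) :
  rotating_soliton A C -> is_derive s (1 : R) C (derive1 C s).
Proof. by case=> _ dC _ _ _; apply: DeriveDef (dC s) _; rewrite derive1E. Qed.

Lemma is_derive_tangent (R : realType) (n : nat) (A : 'M[R]_n)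
    (C : R -> 'cV[R]_n) (s : R) :
  rotating_soliton A C ->
  is_derive s (1 : R) (derive1 C) (A *m C s + lam A C s *: derive1 C s).
Proof.
case=> _ _ dT _ <-; apply: DeriveDef (dT s) _.
by rewrite derive1nS derive1n1 derive1E.
Qed.

Lemma is_derive_dotp_soliton (R : realType) (n : nat) (A : 'M[R]_n)
    (C : R -> 'cV[R]_n) (w : 'cV[R]_n) (s : R) :
  rotating_soliton A C ->
  is_derive s (1 : R) (fun t => dotp (C t) w) (dotp (derive1 C s) w).
Proof.
move=> hC.
have := is_derive_dotp (is_derive_soliton s hC) (is_derive_cst w s 1).
by move=> H; apply: (trigger_derive H); rewrite dotp0r addr0.
Qed.

(** A component of the tangent along the null space satisfies a linear
    equation, since the part [A *m C s] of the acceleration is orthogonal to the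
    null space. *)
Lemma is_derive_dotp_tangent (R : realType) (n : nat) (A : 'M[R]_n)
    (C : R -> 'cV[R]_n) (w : 'cV[R]_n) (s : R) :
  rotating_soliton A C -> null_space A w ->
  is_derive s (1 : R) (fun t => dotp (derive1 C t) w)
    (lam A C s * dotp (derive1 C s) w).
Proof.
move=> hC Aw; have [AT _ _ _ _] := hC.
have := is_derive_dotp (is_derive_tangent s hC) (is_derive_cst w s 1).
move=> H; apply: (trigger_derive H).
by rewrite dotpDl dotpZl dotp_mulmx_anti// Aw !dotp0r oppr0 add0r addr0.
Qed.

Lemma is_derive_lam (R : realType) (n : nat) (A : 'M[R]_n)
    (C : R -> 'cV[R]_n) (s : R) :
  rotating_soliton A C ->
  is_derive s (1 : R) (lam A C)
    (lam A C s ^+ 2 - dotp (A *m C s) (A *m C s)).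
Proof.
move=> hC; have [AT _ _ _ _] := hC.
have := is_deriveN (is_derive_dotp (is_derive_mulmx A (is_derive_soliton s hC))
  (is_derive_tangent s hC)).
move=> H; apply: (trigger_derive H).
have -> : dotp (A *m derive1 C s) (derive1 C s) = 0.
  have := dotp_mulmx_anti (derive1 C s) (derive1 C s) AT.
  by rewrite [X in _ = - X]dotpC; lra.
rewrite dotpDr dotpZr; have -> : dotp (A *m C s) (derive1 C s) = - lam A C s.
  by rewrite opprK.
ring.
Qed.

(** The derivative of [lam] is minus the squared curvature of the soliton. *)
Lemma lam_nonincreasing (R : realType) (n : nat) (A : 'M[R]_n)
    (C : R -> 'cV[R]_n) :
  rotating_soliton A C -> {homo lam A C : x y / x <= y >-> y <= x}.
Proof.
move=> hC a b ab; rewrite -lerN2.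
apply: (le_of_derive_ge0 (f := - lam A C) _ ab) => [s|s _].
  by apply: is_deriveN; exact: is_derive_lam.
have [_ _ _ T1 _] := hC.
have TT : dotp (derive1 C s) (derive1 C s) = 1.
  by rewrite -[LHS]sqr_sqrtr ?dotp_ge0// -/(enorm _) T1 expr1n.
have := dotp_ge0 (A *m C s + lam A C s *: derive1 C s).
rewrite dotpDl !dotpDr !dotpZl !dotpZr TT (dotpC (derive1 C s)).
have -> : dotp (A *m C s) (derive1 C s) = - lam A C s by rewrite opprK.
lra.
Qed.

(** If [lam] vanishes identically, so does its derivative [- |A C|^2]. *)
Lemma stationary_of_lam0 (R : realType) (n : nat) (A : 'M[R]_n)
    (C : R -> 'cV[R]_n) :
  rotating_soliton A C -> (forall s, lam A C s = 0) -> stationary_line A C.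
Proof.
move=> hC lam0 s; apply: dotp_eq0.
have [_] := is_derive_lam s hC.
have -> : lam A C = cst 0 by apply/funext => t; rewrite lam0.
rewrite derive_cst /= expr0n /= sub0r => /eqP.
by rewrite eq_sym oppr_eq0 => /eqP.
Qed.

(** * The projection of a soliton onto the null space *)

(** Unless it is constant, the projection runs monotonically along a line with
    a nowhere vanishing speed. *)
Lemma projection_profile (R : realType) (n : nat) (A : 'M[R]_n)
    (C Z : R -> 'cV[R]_n) :
  rotating_soliton A C ->
  (forall s, orth_proj (null_space A) (C s) (Z s)) ->
  (forall s, Z s = Z 0) \/
  exists v g u, [/\ v != 0, null_space A v, profile (lam A C) g u &
    forall s, Z s = Z 0 + u s *: v].
Proof.
move=> hC hZ; case: (pselect (forall s, Z s = Z 0)) => [|Zn]; first by left.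
right; have [s1 Zs1] : exists s, Z s - Z 0 != 0.
  apply: contrapT => H; apply: Zn => s; apply/eqP; rewrite -subr_eq0.
  by apply/negPn/negP => sn; apply: H; exists s.
have lamN := lam_nonincreasing hC.
pose N := null_space A.
have NB x y : N x -> N y -> N (x - y).
  by rewrite /N /null_space /= mulmxBr => -> ->; rewrite subrr.
have NZ a x : N x -> N (a *: x).
  by rewrite /N /null_space /= -scalemxAr => ->; rewrite scaler0.
have NZs s : N (Z s) by case: (hZ s).
have CZ s w : N w -> dotp (C s) w = dotp (Z s) w.
  by move=> Nw; have [_ /(_ w Nw)] := hZ s; rewrite dotpBl => /subr0_eq.
have cst_dotp w : N w -> dotp (derive1 C 0) w = 0 ->
    forall s, dotp (C s) w = dotp (C 0) w.
  move=> Nw g0 s; apply: (@is_derive_0_is_cst R (fun t => dotp (C t) w)) => x.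
  have := is_derive_dotp_soliton w x hC.
  have dTw t := is_derive_dotp_tangent t hC Nw.
  by have /= -> := linear_ode_zero lamN dTw g0 x.
(* Since f s1 - f 0 is the squared length of w0, f is not constant, so its
   derivative g vanishes nowhere; u is f normalized to have u 0 = 0 and unit
   speed at time 0, which makes the speed positive at all times. *)
pose w0 := Z s1 - Z 0; have Nw0 : N w0 by exact: NB.
pose f s := dotp (C s) w0; pose g s := dotp (derive1 C s) w0.
have df s : is_derive s (1 : R) f (g s) by exact: is_derive_dotp_soliton hC.
have dg s : is_derive s (1 : R) g (lam A C s * g s).
  exact: is_derive_dotp_tangent.
have w00 : dotp w0 w0 != 0 by apply: contra_neq Zs1; exact: dotp_eq0.
have fs1 : f s1 - f 0 = dotp w0 w0 by rewrite /f !CZ// -dotpBl.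
have g0 s : g s != 0.
  apply/eqP => gs; move/eqP: w00; apply.
  have g00 := linear_ode_zero lamN dg gs 0.
  by rewrite -fs1 /f (cst_dotp _ Nw0 g00) subrr.
pose u s := (g 0)^-1 * (f s - f 0); pose h s := (g 0)^-1 * g s.
have du s : is_derive s (1 : R) u (h s).
  have ? := df s; have -> : u = (g 0)^-1 *: (f - cst (f 0)) by [].
  by apply: trigger_derive; rewrite /GRing.scale /= subr0.
have dh s : is_derive s (1 : R) h (lam A C s * h s).
  have ? := dg s; have -> : h = (g 0)^-1 *: g by [].
  by apply: trigger_derive; rewrite /GRing.scale /= /h mulrCA.
have h0 s : 0 < h s.
  rewrite ltNge; apply/negP => hs.
  have [|c hc] := IVT_derive (a := s) (b := 0) (v := 0) dh.
    by rewrite hs /= /h mulVf.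
  by move/eqP: hc; rewrite mulf_eq0 invr_eq0 (negbTE (g0 _)) (negbTE (g0 _)).
exists ((g 0 / dotp w0 w0) *: w0), h, u; split=> //.
- rewrite scaler_eq0 negb_or Zs1 andbT mulf_neq0// invr_eq0//.
- exact: NZ.
move=> s; apply/eqP; rewrite -subr_eq0; apply/eqP; apply: dotp_eq0.
move Ey : (Z s - _) => y; have Ny : N y.
  by rewrite -Ey opprD addrA; apply: (NB); [exact: NB|do 2!apply: (NZ)].
(* Every component of the displacement along the null space is proportional
   to that along w0, by uniqueness for the linear equation. *)
pose c := dotp (derive1 C 0) y / g 0.
have fy t : dotp (Z t - Z 0) y = c * (f t - f 0).
  have Nyc : N (y - c *: w0) by apply: (NB) => //; exact: NZ.
  have cg : dotp (derive1 C 0) (y - c *: w0) = 0.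
    by rewrite dotpBr dotpZr -/(g 0) divfK ?subrr.
  have := cst_dotp _ Nyc cg t; rewrite !dotpBr !dotpZr -/(f t) -/(f 0).
  by rewrite dotpBl !CZ//; lra.
have := fy s1; rewrite fs1 -/w0 => w0y.
rewrite -[X in dotp X _]Ey opprD addrA dotpBl fy !dotpZl w0y /u.
by field; rewrite g0 w00.
Qed.

(** * Motion along a line *)

Lemma line_reparam (R : realType) (n : nat) (P v : 'cV[R]_n) (a b : R) :
  b != 0 -> line P v = line (P + a *: v) (b *: v).
Proof.
move=> b0; apply/seteqP; split=> _ [t _ <-].
- exists ((t - a) / b) => //.
  by rewrite scalerA divfK// -addrA -scalerDl subrKC.
- by exists (a + t * b) => //; rewrite scalerDl scalerA addrA.
Qed.

(** A half line and a segment both start like a ray at each of their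
    endpoints. *)
Lemma endpointP (R : realType) (n : nat) (l m : set 'cV[R]_n) (P : 'cV[R]_n) :
  endpoint l m P -> exists w, [/\ w != 0, m `<=` ray P w &
    forall t, 0 < t < 1 -> m (P + t *: w)].
Proof.
case=> [[v [v0 _ ->]]|[Q [_ _ PQ ->]]].
- by exists v; split=> // t /andP[t0 _]; exists t.
- exists (Q - P); split=> [|_ [t /andP[t0 _] <-]|t t01]; last by exists t.
    by rewrite subr_eq0 eq_sym.
  by exists t.
Qed.

Lemma cvg_line (R : realType) (n : nat) (F : set_system R) (u : R -> R)
    (P v : 'cV[R]_n) (c : R) {FF : ProperFilter F} :
  u s @[s --> F] --> c -> (P + u s *: v) @[s --> F] --> P + c *: v.
Proof. by move=> uc; apply: cvgD; [exact: cvg_cst|exact: cvgZr_tmp]. Qed.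

Lemma cvg_line_coord (R : realType) (n : nat) (F : set_system R) (u : R -> R)
    (P Q v : 'cV[R]_n) {FF : ProperFilter F} : v != 0 ->
  (P + u s *: v) @[s --> F] --> Q ->
  exists2 c, Q = P + c *: v & u s @[s --> F] --> c.
Proof.
move=> v0 uQ.
have [i vi] : exists i, v i 0 != 0.
  apply: contrapT => H; move/eqP: v0; apply; apply/matrixP => i j.
  rewrite ord1 mxE; apply/eqP/negPn/negP => vi; apply: H; by exists i.
have uc : u s @[s --> F] --> (Q i 0 - P i 0) / v i 0.
  have -> : u = (fun s => ((P + u s *: v) i 0 - P i 0) / v i 0).
    by apply/funext => s; rewrite !mxE addrC addKr mulfK.
  apply: cvgMr_tmp; apply: cvgB; last exact: cvg_cst.
  exact: (cvg_comp _ _ uQ (@coord_continuous _ _ _ i 0 Q)).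
exists ((Q i 0 - P i 0) / v i 0) => //.
apply: etrans (esym (cvg_lim (@norm_hausdorff _ _) uQ)) _.
by apply: (cvg_lim (@norm_hausdorff _ _)); exact: cvg_line.
Qed.

Lemma line_exp_rate (R : realType) (n : nat) (lam g u : R -> R)
    (Z : R -> 'cV[R]_n) (P0 P v : 'cV[R]_n) :
  profile lam g u -> v != 0 -> (forall s, Z s = P0 + u s *: v) ->
  Z s @[s --> +oo] --> P ->
  exists K d, [/\ 0 < K, 0 < d &
    forall s, enorm (Z s - P) <= K * expR (- d * s)].
Proof.
move=> pu v0 Zu; have /funext-> := Zu => /(cvg_line_coord v0)[c -> uc].
have uc_le s : u s <= c.
  rewrite -(cvg_lim _ uc)//; apply: limr_ge; first exact: cvgP uc.
  near=> t; rewrite (profile_mono pu); near: t.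
  by apply: nbhs_pinfty_ge; exact: num_real.
have [s0 lam0] := profile_bounded_lam pu uc_le.
have [K [d [K0 d0 Kd]]] := profile_tail pu lam0.
exists (K * enorm v), d; split=> // [|s]; first by rewrite mulr_gt0// enorm_gt0.
have -> : P0 + u s *: v - (P0 + c *: v) = (u s - c) *: v.
  by rewrite opprD addrACA subrr add0r scalerBl.
rewrite enormZ mulrAC ler_wpM2r ?sqrtr_ge0// ler0_norm ?subr_le0// opprB.
rewrite lerBlDr -(cvg_lim _ uc)//; apply: limr_le; first exact: cvgP uc.
by near=> t; rewrite -lerBlDr.
Unshelve. all: by end_near. Qed.

Lemma line_endpoint_cvg (R : realType) (n : nat) (u : R -> R)
    (Z : R -> 'cV[R]_n) (l : set 'cV[R]_n) (P0 P v : 'cV[R]_n) :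
  {homo u : x y / x <= y} -> v != 0 -> (forall s, Z s = P0 + u s *: v) ->
  endpoint l (range Z) P ->
  (Z s @[s --> +oo] --> P) \/ (Z s @[s --> -oo] --> P).
Proof.
move=> um v0 Zu /endpointP[w [w0 Zw wZ]].
have wZu t : 0 < t < 1 -> exists s, P0 + u s *: v = P + t *: w.
  by move=> /wZ[s _ <-]; exists s; rewrite Zu.
(* Any two points of the ray determine its direction and origin in terms of v
   and P0. *)
have [|a Pa] := wZu (1 / 2); first by apply/andP; split; lra.
have [|b Pb] := wZu (1 / 4); first by apply/andP; split; lra.
pose k := 4 * (u a - u b); pose e := 2 * u b - u a.
have wk : w = k *: v.
  have : P0 + u a *: v - (P0 + u b *: v) =
      P + (1 / 2) *: w - (P + (1 / 4) *: w).
    by rewrite Pa Pb.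
  rewrite !opprD (addrACA P0) (addrACA P) !subrr !add0r -!scalerBl => ab.
  rewrite /k -scalerA ab scalerA.
  by have -> : 4 * (1 / 2 - 1 / 4) = 1 :> R by [field]; rewrite scale1r.
have Pe : P = P0 + e *: v.
  have -> : P = P0 + u a *: v - (1 / 2) *: w by rewrite Pa addrK.
  rewrite wk scalerA -addrA -scalerBl; congr (_ + _ *: _).
  by rewrite /e /k; field.
have k0 : k != 0 by apply: contra_neq w0 => k0; rewrite wk k0 scale0r.
have ray_u s t : P0 + u s *: v = P + t *: w -> u s = e + t * k.
  rewrite Pe wk scalerA -addrA -scalerDl => /addrI; exact: scale_vector_inj.
have : (u s @[s --> +oo] --> e) \/ (u s @[s --> -oo] --> e).
  apply: (mono_cvg_end um k0) => [s|t t01].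
  - have [|t t0] := Zw (Z s); first by exists s.
    by rewrite Zu => /esym/ray_u ->; exists t.
  - by have [s /ray_u] := wZu t t01; exists s.
by rewrite (funext Zu) Pe => -[ue|ue]; [left|right]; exact: cvg_line.
Qed.

Lemma graph_over_of_inj (R : realType) (n : nat) (A : 'M[R]_n)
    (C Z : R -> 'cV[R]_n) :
  A^T = - A -> (forall s, orth_proj (null_space A) (C s) (Z s)) ->
  injective Z -> graph_over A (range C) (range Z).
Proof.
move=> AT hZ Zinj.
pose f z := C (xget 0 [set s | Z s = z]) - z.
have fZ s : f (Z s) = C s - Z s.
  congr (C _ - _); apply: Zinj.
  by apply: (xgetPex 0 (P := [set t | Z t = Z s])); exists s.
exists f; split=> [_ [s _ <-]|].
  by rewrite fZ; apply: range_space_orth => //; case: (hZ s).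
apply/seteqP; split=> [_ [s _ <-]|_ [_ [s _ <-] <-]].
- by exists (Z s); [exists s|rewrite fZ subrKC].
- by exists s => //; rewrite fZ subrKC.
Qed.

(** A negative value of [lam] bounds the motion in the direction [v], a positive
    value in the direction [- v]; without one the motion is unbounded on that
    side. *)
Lemma range_projection (R : realType) (n : nat) (lam g u : R -> R)
    (Z : R -> 'cV[R]_n) (v : 'cV[R]_n) :
  profile lam g u -> v != 0 -> (forall s, Z s = Z 0 + u s *: v) ->
  ~ (forall s, lam s = 0) ->
  (exists P, half_line_of (line (Z 0) v) (range Z) P) \/
  (exists P Q, segment_of (line (Z 0) v) (range Z) P Q).
Proof.
move=> pu v0 Zu lamn0.
have Nv a : - a *: v = a *: - v by rewrite scaleNr scalerN.
case: (pselect (exists s, lam s < 0)) =>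
    [[s1 /(profile_sup pu)[L2 [uL2 L2u]]]|nneg];
    case: (pselect (exists s, 0 < lam s)) =>
      [[s2 /(profile_inf pu)[L1 [uL1 L1u]]]|npos].
- right; exists (Z 0 + L1 *: v), (Z 0 + L2 *: v).
  have L12 : L1 < L2 by apply: lt_trans (uL1 0) (uL2 0).
  have seg t : Z 0 + L1 *: v + t *: (Z 0 + L2 *: v - (Z 0 + L1 *: v)) =
      Z 0 + (L1 + t * (L2 - L1)) *: v.
    by rewrite opprD addrACA subrr add0r -scalerBl scalerA -addrA -scalerDl.
  split; [by exists L1|by exists L2| |].
  + by apply/eqP => /addrI/(scale_vector_inj v0) L12E; rewrite L12E ltxx in L12.
  + apply/seteqP; split=> [_ [s _ <-]|_ [t /andP[t0 t1] <-]].
    * have LL0 : 0 < L2 - L1 by rewrite subr_gt0.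
      exists ((u s - L1) / (L2 - L1)).
        by rewrite /= divr_gt0 ?subr_gt0//= ltr_pdivrMr// mul1r ltrD2r.
      by rewrite seg divfK ?gt_eqF// subrKC -Zu.
    * have yL1 : L1 < L1 + t * (L2 - L1) by rewrite ltrDl mulr_gt0// subr_gt0.
      have yL2 : L1 + t * (L2 - L1) < L2.
        by rewrite -ltrBrDl gtr_pMl// subr_gt0.
      have [a /ltW au] := L1u _ yL1; have [b /ltW ub] := L2u _ yL2.
      by have [s us] := profile_surj pu au ub; exists s; rewrite // seg Zu us.
- left; exists (Z 0 + L2 *: v), (- v); split; first by rewrite oppr_eq0.
    by rewrite (line_reparam _ _ L2 (b := -1)) ?scaleN1r// oppr_eq0 oner_eq0.
  apply/seteqP; split=> [_ [s _ <-]|_ [t t0 <-]].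
  + exists (L2 - u s); first by rewrite /= subr_gt0.
    by rewrite -Nv opprB -addrA -scalerDl subrKC -Zu.
  + have yL2 : L2 - t < L2 by rewrite ltrBlDr ltrDl.
    have [b /ltW ub] := L2u _ yL2.
    have [|a au] := profile_unbounded_below pu _ (L2 - t).
      by move=> s; rewrite leNgt; apply/negP => ?; apply: npos; exists s.
    have [s us] := profile_surj pu au ub; exists s => //.
    by rewrite -Nv -addrA -scalerDl Zu us.
- left; exists (Z 0 + L1 *: v), v; split=> //.
    by rewrite (line_reparam _ _ L1 (b := 1)) ?scale1r// oner_eq0.
  apply/seteqP; split=> [_ [s _ <-]|_ [t t0 <-]].
  + exists (u s - L1); first by rewrite /= subr_gt0.
    by rewrite -addrA -scalerDl subrKC -Zu.
  + have yL1 : L1 < L1 + t by rewrite ltrDl.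
    have [a /ltW au] := L1u _ yL1.
    have [|b ub] := profile_unbounded pu _ (L1 + t).
      by move=> s; rewrite leNgt; apply/negP => ?; apply: nneg; exists s.
    have [s us] := profile_surj pu au ub; exists s => //.
    by rewrite -addrA -scalerDl Zu us.
- exfalso; apply: lamn0 => s; apply/eqP; rewrite eq_le !leNgt; apply/andP.
  by split; apply/negP => ?; [apply: npos|apply: nneg]; exists s.
Qed.

Lemma cst_not_endpoint (R : realType) (n : nat) (Z : R -> 'cV[R]_n)
    (l : set 'cV[R]_n) (P : 'cV[R]_n) :
  (forall s, Z s = Z 0) -> ~ endpoint l (range Z) P.
Proof.
move=> Z0 /endpointP[w [w0 _ wZ]].
have [|a _ Pa] := wZ (1 / 2); first by apply/andP; split; lra.
have [|b _ Pb] := wZ (1 / 4); first by apply/andP; split; lra.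
have : P + (1 / 2) *: w = P + (1 / 4) *: w by rewrite -Pa -Pb Z0 [RHS]Z0.
by move=> /addrI/(scale_vector_inj w0); lra.
Qed.

Lemma cst_exp_rate (R : realType) (n : nat) (F : set_system R)
    (Z : R -> 'cV[R]_n) (P : 'cV[R]_n) {FF : ProperFilter F} :
  (forall s, Z s = Z 0) -> Z s @[s --> F] --> P ->
  exists K d : R, [/\ 0 < K, 0 < d &
    forall s, enorm (Z s - P) <= K * expR (- d * `|s|)].
Proof.
move=> /funext-> ZP; exists 1, 1; split=> // s.
have PZ : P = Z 0.
  apply: etrans (esym (cvg_lim (@norm_hausdorff _ _) ZP)) _.
  by apply: (cvg_lim (@norm_hausdorff _ _)); exact: cvg_cst.
by rewrite PZ subrr -(scale0r 0) enormZ normr0 mul0r mulr_ge0// expR_ge0.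
Qed.

Theorem lemma5p4 (R : realType) (n : nat) (A : 'M[R]_n)
    (C Z : R -> 'cV[R]_n)
    (hC : rotating_soliton A C)
    (hZ : forall s, orth_proj (null_space A) (C s) (Z s)) :
  exists l : set 'cV[R]_n,
  [/\ line_in_null_space A l /\ range Z `<=` l,
      ~ stationary_line A C ->
        [\/ is_point (range Z),
            exists P, half_line_of l (range Z) P |
            exists P Q, segment_of l (range Z) P Q],
      (exists P, half_line_of l (range Z) P) \/
      (exists P Q, segment_of l (range Z) P Q) ->
        graph_over A (range C) (range Z),
      forall P : 'cV[R]_n, endpoint l (range Z) P ->
        (Z s @[s --> +oo] --> P) \/ (Z s @[s --> -oo] --> P) &
      forall P : 'cV[R]_n,
        ((Z s @[s --> +oo] --> P) ->
          exists K d : R, [/\ 0 < K, 0 < d &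
            forall s : R, 0 <= s -> enorm (Z s - P) <= K * expR (- d * `|s|)]) /\
        ((Z s @[s --> -oo] --> P) ->
          exists K d : R, [/\ 0 < K, 0 < d &
            forall s : R, s <= 0 -> enorm (Z s - P) <= K * expR (- d * `|s|)])].
Proof.
have AT : A^T = - A by case: hC.
have line_null P v : null_space A P -> null_space A v ->
    line P v `<=` null_space A.
  rewrite /null_space /= => AP Av _ [t _ <-].
  by rewrite /= mulmxDr -scalemxAr AP Av scaler0 addr0.
have NZ s : null_space A (Z s) by case: (hZ s).
case: (projection_profile hC hZ) => [Z0|[v [g [u [v0 Av pu Zu]]]]].
- have [l [Al Zl]] : exists l, line_in_null_space A l /\ range Z `<=` l.
    case: (pselect (exists2 w, w != 0 & null_space A w)) => [[w w0 Aw]|N0].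
      exists (line (Z 0) w); split; first by left; exists (Z 0), w; split; auto.
      by move=> _ [s _ <-]; exists 0 => //; rewrite scale0r addr0 [RHS]Z0.
    (* A trivial null space contains no line, only the point 0. *)
    have N00 : null_space A = [set 0].
      apply/seteqP; split=> [w Aw|_ ->]; last exact: mulmx0.
      by apply/eqP/negPn/negP => w0; apply: N0; exists w.
    exists [set 0]; split; first by right.
    by rewrite -N00 => _ [s _ <-].
  exists l; split=> // [_|H|P /(cst_not_endpoint Z0)//|P].
  + apply: Or31; exists (Z 0); apply/seteqP; split=> [_ [s _ <-]|_ ->].
      exact: Z0.
    by exists 0.
  + exfalso; case: H => [[P hP]|[P [Q hPQ]]].
      by apply: (@cst_not_endpoint _ _ _ l P Z0); left.
    by apply: (@cst_not_endpoint _ _ _ l P Z0); right; exists Q.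
  + by split=> /(cst_exp_rate Z0)[K [d [K0 d0 Kd]]]; exists K, d; split.
- have um : {homo u : x y / x <= y}.
    by move=> x y; rewrite (profile_mono pu).
  exists (line (Z 0) v); split=> [|nst|_|P|P].
  + split; first by left; exists (Z 0), v; split; auto.
    by move=> _ [s _ <-]; exists (u s) => //; rewrite -Zu.
  + have [|H|H] := range_projection pu v0 Zu; [|exact: Or32|exact: Or33].
    by move=> lam0; apply: nst; exact: stationary_of_lam0.
  + apply: graph_over_of_inj => // a b.
    rewrite Zu [RHS]Zu => /addrI/(scale_vector_inj v0) uab.
    apply/eqP; rewrite eq_le -(profile_mono pu a b) -(profile_mono pu b a).
    by rewrite uab lexx.
  + by apply: (line_endpoint_cvg um v0 Zu).
  + split=> [ZP|/cvgNy_compNP ZP].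
    * have [K [d [K0 d0 Kd]]] := line_exp_rate pu v0 Zu ZP.
      by exists K, d; split=> // s s0; rewrite ger0_norm.
    * have ZuN s : (Z \o -%R) s = Z 0 + (- u (- s)) *: - v.
        by rewrite /= Zu scaleNr scalerN opprK.
      have vN0 : - v != 0 by rewrite oppr_eq0.
      have [K [d [K0 d0 Kd]]] := line_exp_rate (profile_reverse pu) vN0 ZuN ZP.
      exists K, d; split=> // s s0; rewrite ler0_norm//.
      by have := Kd (- s); rewrite /= opprK.
Qed.
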